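(* Let $G\le \mathrm{Atop}(C)$ be an autotopy group (a subgroup of the full autotopy group) of $C\in\mathcal{P}^n(v,k,\lambda)$. For any $x\in\{1,\ldots,n\}$, $G_x=\{\pi_x\mid \pi=(\pi_1,\ldots,\pi_n)\in G\}$ is a permutation group acting on $\{1,\ldots,v\}$, and the number of orbits of $G_x$ does not depend on the choice of $x$.
   Context: An incidence matrix of a symmetric $(v,k,\lambda)$ design is a $v\times v$ matrix $A$ with $\{0,1\}$-entries satisfying $AA^t=(k-\lambda)I+\lambda J$, where $I$ is the identity matrix and $J$ the all-ones matrix; parameters are assumed nondegenerate, $0\le\lambda<k$. For $n\ge 2$, $\mathcal{P}^n(v,k,\lambda)$ is the set of all functions $C:\{1,\ldots,v\}^n\to\{0,1\}$ such that for all $1\le x<y\le n$ the $2$-projection $\Pi_{xy}(C)$ is an incidence matrix of a symmetric $(v,k,\lambda)$ design; here $\Pi_{xy}(C)$ is the $v\times v$ matrix whose $(i_x,i_y)$-entry is the sum (in characteristic $0$) of $C(i_1,\ldots,i_n)$ over all $n$-tuples in $\{1,\ldots,v\}^n$ with the given coordinates $i_x,i_y$. An autotopy of $C$ is an $n$-tuple $(\pi_1,\ldots,\pi_n)\in (S_v)^n$ such that $C(i_1,\ldots,i_n)=C(\pi_1^{-1}(i_1),\ldots,\pi_n^{-1}(i_n))$ for all $i_1,\ldots,i_n\in\{1,\ldots,v\}$. The set of all autotopies of $C$ is a group under coordinatewise composition, the full autotopy group $\mathrm{Atop}(C)$. *)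

(* Defs.v *)
From HB Require Import structures.
From mathcomp Require Import all_boot all_order all_algebra all_fingroup.

Set Implicit Arguments.
Unset Strict Implicit.
Unset Printing Implicit Defensive.

Import GRing.Theory.
Local Open Scope ring_scope.

(* Each coordinate set {1, ..., v} is rendered as 'I_v, and the set {1, ..., n}
   of coordinate positions as 'I_n. *)
Definition index_tuple (n v : nat) := {ffun 'I_n -> 'I_v}.

Definition array (n v : nat) := {ffun index_tuple n v -> bool}.

(* The entries are summed in int, so that the projection of a {0,1}-array may
   have entries other than 0 and 1. *)
Definition projection2 n v (C : array n v) (x y : 'I_n) : 'M[int]_v :=
  \matrix_(a, b) \sum_(i : index_tuple n v | (i x == a) && (i y == b)) (C i)%:R.

Definition incidence_mx (v k lambda : nat) (A : 'M[int]_v) : bool :=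
  [forall i, forall j, (A i j == 0) || (A i j == 1)] &&
  (A *m A^T == (k%:R - lambda%:R)%:M + lambda%:R *: const_mx 1).

Definition design_cubes (n v k lambda : nat) : {set array n v} :=
  [set C | [forall x : 'I_n, forall y : 'I_n,
              (x < y)%N ==> incidence_mx k lambda (projection2 C x y)]].

(* The direct power (S_v)^n with the coordinatewise group law of gproduct;
   permutations compose left to right: (s * t) a = t (s a). *)
Notation isotopies n v := {dffun forall _ : 'I_n, {perm 'I_v}}.

Definition Atop n v (C : array n v) : {set isotopies n v} :=
  [set p : isotopies n v |
    [forall i : index_tuple n v,
       C i == C [ffun j => ((p j)^-1)%g (i j)]]].

Lemma Atop_group_set n v (C : array n v) : group_set (Atop C).
Proof.
apply/group_setP; split=> [|p q].
  rewrite inE; apply/forallP => i; apply/eqP; congr (C _).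
  by apply/ffunP => j; rewrite !ffunE invg1 perm1.
rewrite !inE => /forallP Hp /forallP Hq; apply/forallP => i.
rewrite (eqP (Hq i)) (eqP (Hp _)); apply/eqP; congr (C _).
by apply/ffunP => j; rewrite !ffunE invMg permM.
Qed.

Canonical Atop_group n v (C : array n v) := Group (Atop_group_set C).

Definition component n v (G : {set isotopies n v}) (x : 'I_n) :
    {set {perm 'I_v}} :=
  [set (p : isotopies n v) x | p in G].

Definition num_orbits v (H : {set {perm 'I_v}}) : nat :=
  #|[set orbit 'P H a | a : 'I_v]|.

(* Main.v *)
(** An autotopy permutes the rows and columns of the projection matrix [A] by
    [p x] and [p y] while fixing it, i.e. [P A = A Q] for the corresponding
    permutation matrices.  As [A A^T = (k - lambda) I + lambda J] is positive
    definite, [A] is invertible, so [P] and [Q] have equal traces: [p x] and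
    [p y] have equally many fixed points.  Burnside's orbit-counting lemma for
    the actions of [G] on coordinates [x] and [y] then equates the numbers of
    orbits. *)

Require Import Defs.
From mathcomp Require Import all_boot all_order all_algebra all_fingroup.

Set Implicit Arguments.
Unset Strict Implicit.
Unset Printing Implicit Defensive.

Import Order.TTheory GRing.Theory Num.Theory.
Local Open Scope ring_scope.

(** If [u *m B = 0] over [rat], then [0 = u B B^T u^T], which equals [(k - lambda)] times the sum of
    the [u_j ^+ 2] plus [lambda] times the square of the sum of the [u_j]. Both terms are
    nonnegative and [k - lambda > 0], so [u = 0]. *)
Lemma incidence_mx_unit v k lambda (A : 'M[int]_v) :
  (lambda < k)%N -> incidence_mx k lambda A ->
  map_mx (intr : int -> rat) A \in unitmx.
Proof.
move=> ltlk /andP[_ /eqP AAt]; rewrite -row_free_unit.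
apply: inj_row_free => u uA0; set B := map_mx _ A in uA0.
have BBt : B *m B^T = (k%:R - lambda%:R)%:M + lambda%:R *: const_mx 1.
  rewrite /B map_trmx -map_mxM AAt map_mxD map_scalar_mx map_mxZ.
  by rewrite map_const_mx /= rmorphB !rmorph_nat rmorph1.
have u1E : u *m const_mx 1 = const_mx (\sum_j u 0 j) :> 'rV_v.
  by apply/rowP => j; rewrite !mxE; apply: eq_bigr => l _; rewrite mxE mulr1.
have : (u *m (B *m B^T) *m u^T) 0 0 = 0 by rewrite mulmxA uA0 !mul0mx mxE.
have -> : (u *m (B *m B^T) *m u^T) 0 0 =
    (k%:R - lambda%:R) * (\sum_j u 0 j ^+ 2) + lambda%:R * (\sum_j u 0 j) ^+ 2.
  rewrite BBt mulmxDr mul_mx_scalar -scalemxAr u1E mulmxDl -!scalemxAl.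
  rewrite !mxE; congr (_ * _ + _ * _).
    by apply: eq_bigr => j _; rewrite mxE.
  by rewrite expr2 mulr_sumr; apply: eq_bigr => j _; rewrite !mxE.
have c_gt0 : 0 < k%:R - lambda%:R :> rat by rewrite subr_gt0 ltr_nat.
have sq_ge0 : 0 <= \sum_j u 0 j ^+ 2.
  by apply: sumr_ge0 => j _; apply: sqr_ge0.
have sum_sq_ge0 : 0 <= lambda%:R * (\sum_j u 0 j) ^+ 2.
  by apply: mulr_ge0; [apply: ler0n | apply: sqr_ge0].
move/eqP; rewrite paddr_eq0 ?(pmulr_rge0 _ c_gt0) //.
rewrite mulf_eq0 gt_eqF //= psumr_eq0 => [/andP[/allP u0 _]|j _]; last first.
  exact: sqr_ge0.
apply/rowP => j; rewrite [RHS]mxE; apply/eqP.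
by rewrite -sqrf_eq0; apply: u0; rewrite mem_index_enum.
Qed.

Lemma mxtrace_perm_mx (R : nzRingType) v (s : {perm 'I_v}) :
  \tr (perm_mx s) = #|[set a | s a == a]|%:R :> R.
Proof.
rewrite /mxtrace cardsE -sum1_card natr_sum [RHS]big_mkcond /=.
by apply: eq_bigr => a _; rewrite !mxE mulrb.
Qed.

Section Autotopies.

Variables (n v : nat) (C : array n v).
Implicit Types (p : isotopies n v) (x y : 'I_n).

Lemma projection2_perm p x y (a b : 'I_v) : p \in Atop C ->
  projection2 C x y (p x a) (p y b) = projection2 C x y a b.
Proof.
rewrite inE => /forallP Cp; rewrite !mxE.
pose h (i : index_tuple n v) : index_tuple n v := [ffun j => p j (i j)].
pose h' (i : index_tuple n v) : index_tuple n v := [ffun j => (p j)^-1%g (i j)].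
have hK : cancel h h' by move=> i; apply/ffunP => j; rewrite !ffunE permK.
have hK' : cancel h' h by move=> i; apply/ffunP => j; rewrite !ffunE permKV.
(* [h] carries the tuples through [(a, b)] bijectively to those through [(p x a, p y b)] and
   preserves [C]. *)
rewrite (reindex h) /=; last by exists h' => i _.
apply: eq_big => [i|i _]; first by rewrite !ffunE !(inj_eq perm_inj).
by rewrite (eqP (Cp _)) -/(h' _) hK.
Qed.

Lemma card_fix_autotopy k lambda p x y :
    (lambda < k)%N -> incidence_mx k lambda (projection2 C x y) ->
    p \in Atop C ->
  #|[set a | p x a == a]| = #|[set a | p y a == a]|.
Proof.
move=> ltlk incA Cp; have uA := incidence_mx_unit ltlk incA.
set A := map_mx _ _ in uA.
have PA : perm_mx (p x) *m A = A *m perm_mx (p y).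
  (* Entrywise, [A (p x a) b = A a b'] with [b' = (p y)^-1 b]; writing [b] as [p y b'] reduces this
     to invariance of the projection. *)
  rewrite -row_permE -[p y]invgK -col_permE; apply/matrixP => a b.
  by rewrite mxE [RHS]mxE !(mxE map_mx_key) -{1}(permKV (p y) b) projection2_perm.
apply/eqP; rewrite -(eqr_nat rat) -!mxtrace_perm_mx.
(* With [P] and [Q] the two permutation matrices, [P = A Q A^-1], so the traces agree. *)
by rewrite -[perm_mx (p x)](mulmxK uA) PA mxtrace_mulC mulKmx.
Qed.

(** All coordinates become actions of the one group [G], whereas the groups [component G x] may have
    different orders. *)
Definition coord_act x (a : 'I_v) p := p x a.

Lemma coord_act1 x a : coord_act x a 1%g = a.
Proof. by rewrite /coord_act ffunE perm1. Qed.

Lemma coord_actM x a p q :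
  coord_act x a (p * q)%g = coord_act x (coord_act x a p) q.
Proof. by rewrite /coord_act ffunE permM. Qed.

Canonical coord_action x := TotalAction (coord_act1 x) (coord_actM x).

Lemma num_orbits_component (G : {group isotopies n v}) x :
  num_orbits (component G x) = #|orbit (coord_action x) G @: setT|.
Proof.
congr #|pred_of_set _|; apply/setP => X.
have orbE a : orbit 'P (component G x) a = orbit (coord_action x) G a.
  by rewrite /orbit /component -imset_comp.
by apply/imsetP/imsetP => -[a _ ->]; exists a; rewrite ?inE ?orbE.
Qed.

Lemma component_group_set (G : {group isotopies n v}) x :
  group_set (component G x).
Proof.
apply/group_setP; split=> [|_ _ /imsetP[p Gp ->] /imsetP[q Gq ->]].
  by apply/imsetP; exists 1%g; rewrite ?group1 // ffunE.
by apply/imsetP; exists (p * q)%g; rewrite ?groupM // ffunE.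
Qed.

Lemma num_orbits_component_eq k lambda (G : {group isotopies n v}) x y :
    (lambda < k)%N -> incidence_mx k lambda (projection2 C x y) ->
    G \subset Atop C ->
  num_orbits (component G x) = num_orbits (component G y).
Proof.
move=> ltlk incA sGC; rewrite !num_orbits_component; apply/eqP.
have actsT z : [acts G, on setT | coord_action z].
  by apply/actsP => p _ a; rewrite !inE.
(* Multiplied by [#|G|], both orbit counts become sums of fixed-point counts over the same elements
   [p] of [G], compared term by term. *)
rewrite -(eqn_pmul2r (cardG_gt0 G)) -!Frobenius_Cauchy ?actsT //; apply/eqP.
have fixE z p : 'Fix_(setT | coord_action z)[p]%g = [set a | p z a == a].
  by apply/setP => a; rewrite !inE sub1set inE.
apply: eq_bigr => p Gp; rewrite !fixE.
exact: card_fix_autotopy ltlk incA (subsetP sGC p Gp).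
Qed.

End Autotopies.

Local Close Scope ring_scope.

Theorem proposition3p4 (n v k lambda : nat) (hn : 2 <= n) (hkl : lambda < k)
    (C : array n v) (hC : C \in design_cubes n v k lambda)
    (G : {group isotopies n v}) (hG : G \subset Atop C) :
  (forall x : 'I_n, group_set (component G x)) /\
  (forall x y : 'I_n,
     num_orbits (component G x) = num_orbits (component G y)).
Proof.
split=> [x|x y]; first exact: component_group_set.
move: hC; rewrite inE => /forallP incC.
(* The design condition covers only ordered pairs of coordinates; the reverse order follows by
   symmetry of equality. *)
have eq_lt (z w : 'I_n) : z < w ->
    num_orbits (component G z) = num_orbits (component G w).
  move=> ltzw; apply: num_orbits_component_eq hkl _ hG.
  exact: implyP (forallP (incC z) w) ltzw.
by case: (ltngtP x y) => [/eq_lt|/eq_lt/esym|/val_inj->].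
Qed.
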